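(* Let $a\in\mathbf{C}$. Every 2-local automorphism of the transposed Poisson algebra $\mathcal{W}(a,-1)$ is an automorphism. In other words, for any 2-local automorphism $A$ of $\mathcal{W}(a,-1)$ there exist constants $\alpha,\mu\in\mathbf{C}^*$ such that $A$ is the linear map with $$A(L_n)=\alpha^nL_n,\qquad A(I_n)=\mu\alpha^nI_n\qquad(n\in\mathbf{Z}).$$
   Context: All algebras are over $\mathbf{C}$. For $a\in\mathbf{C}$, the transposed Poisson algebra $\mathcal{W}(a,-1)$ is the vector space with basis $\{L_n,I_m\mid n,m\in\mathbf{Z}\}$, with commutative associative product $L_n\cdot L_m=L_{n+m}$, $L_n\cdot I_m=I_{n+m}$, $I_n\cdot I_m=0$, and Lie bracket $[L_n,L_m]=(n-m)L_{n+m}$, $[L_n,I_m]=-(m+a-n)I_{n+m}$, $[I_n,I_m]=0$. An automorphism is a bijective linear map preserving both products. A (not necessarily linear) map $A$ is a 2-local automorphism if for every pair of elements $x,y$ there exists an automorphism $\mathcal{A}_{x,y}$ with $A(x)=\mathcal{A}_{x,y}(x)$ and $A(y)=\mathcal{A}_{x,y}(y)$.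
   Formalization: The explicit form fails for integer a: L_n ↦ L_n + c n I_{n−a}, I_n ↦ I_n is an automorphism for every c. It is proved as stated for non-integer a; for integer a, A(L_n) = α^n(L_n + c n I_{n−a}) with some constant c. That A is an automorphism is proved for all a. *)

(* Defs.v *)
From HB Require Import structures.
From mathcomp Require Import all_boot all_order all_algebra.
From mathcomp Require Import finmap complex reals monalg.

Set Implicit Arguments.
Unset Strict Implicit.
Unset Printing Implicit Defensive.

Import GRing.Theory.
Local Open Scope ring_scope.
Local Open Scope complex_scope.

(* Index of the basis: [inl n] stands for L_n and [inr m] for I_m. *)
Definition basis_index : Type := (int + int)%type.
HB.instance Definition _ := Choice.on basis_index.

(* The carrier of W(a,-1), over C = R[i]: the free vector space on the basis.
   No monoid structure is put on [basis_index], so [Wmul] and [Wbracket] below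
   are the only products on it. *)
Definition W (R : realType) : lmodType R[i] := {malg R[i][basis_index]}.

Definition Lb (R : realType) (n : int) : W R := << inl n >>.
Definition Ib (R : realType) (m : int) : W R := << inr m >>.

Definition bilin_ext (R : realType) (b : basis_index -> basis_index -> W R)
    (x y : W R) : W R :=
  \sum_(i <- msupp x) \sum_(j <- msupp y) (x@_i * y@_j) *: b i j.

Definition mul_basis (R : realType) (i j : basis_index) : W R :=
  match i, j with
  | inl n, inl m => Lb R (n + m)
  | inl n, inr m => Ib R (n + m)
  | inr n, inl m => Ib R (n + m)
  | inr _, inr _ => 0
  end.

Definition bracket_basis (R : realType) (a : R[i]) (i j : basis_index) : W R :=
  match i, j with
  | inl n, inl m => (n - m)%:~R *: Lb R (n + m)
  | inl n, inr m => - (m%:~R + a - n%:~R) *: Ib R (n + m)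
  | inr m, inl n => (m%:~R + a - n%:~R) *: Ib R (n + m)
  | inr _, inr _ => 0
  end.

Definition Wmul (R : realType) : W R -> W R -> W R :=
  bilin_ext (@mul_basis R).
Definition Wbracket (R : realType) (a : R[i]) : W R -> W R -> W R :=
  bilin_ext (bracket_basis a).

Definition is_automorphism (R : realType) (a : R[i]) (f : W R -> W R) : Prop :=
  [/\ linear f, bijective f,
      (forall x y, f (Wmul x y) = Wmul (f x) (f y))
    & (forall x y, f (Wbracket a x y) = Wbracket a (f x) (f y))].

Definition is_2local_automorphism (R : realType) (a : R[i])
    (A : W R -> W R) : Prop :=
  forall x y, exists f : W R -> W R,
    [/\ is_automorphism a f, A x = f x & A y = f y].

Lemma bilin_ext_basis (R : realType)
    (b : basis_index -> basis_index -> W R) (i j : basis_index) :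
  bilin_ext b << i >> << j >> = b i j.
Proof.
rewrite /bilin_ext !msuppU oner_eq0 !big_seq_fset1.
by rewrite !mcoeffUU mulr1 scale1r.
Qed.

(* Main.v *)
From HB Require Import structures.
Require Import Defs.
From mathcomp Require Import all_boot all_order all_algebra.
From mathcomp Require Import complex reals.
From mathcomp Require Import finmap monalg boolp ring.

Set Implicit Arguments.
Unset Strict Implicit.
Unset Printing Implicit Defensive.

Import Order.TTheory GRing.Theory Num.Theory.
Local Open Scope ring_scope.
Local Open Scope complex_scope.

(** Two facts make the theorem true: automorphisms are rigid, and a single
    element of the algebra is moved by all of them but the identity.

    Rigidity. An automorphism f fixes L_0, the unit of the associative product,
    so f commutes with the operator [L_0, -], which is diagonal in the basis:
    it scales L_n by -n and I_m by -(m + a) ([automorphism_weight]). Two basis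
    vectors share an eigenvalue only if they are L_n and I_m with m + a = n,
    which forces a to be an integer k and m = n - k. Therefore f (L_n) is a
    combination x_n L_n + y_n I_(n-k), and f (I_n) a combination of I_n and
    L_(n+k), the second summand in each being absent when a is not an integer.
    The product does the rest: I_0 squares to 0, which kills the component of
    f (I_0) on L_k; L_n L_m = L_(n+m) makes x multiplicative and y a derivation
    along x, so that x_n = alpha^n and y_n = alpha^n c n
    ([int_exponential_derivation]); and I_n = L_n I_0 transports f (I_0) to all
    the I_n. This is [automorphism_form].

    Separation. With parameters (alpha, mu, c) as above, z = L_1 + I_(2-k) goes
    to alpha L_1 + alpha c I_(1-k) + mu alpha^(2-k) I_(2-k). The three basis
    vectors here are distinct, so the image of z gives back the parameters, and
    two automorphisms that agree at z are equal ([standard_form_determined]).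

    For a 2-local automorphism A, let phi be an automorphism with A z = phi z.
    For any x, an automorphism that agrees with A at both z and x agrees with
    phi at z, hence is phi; thus A x = phi x. So A is phi. *)

(** * Linear and bilinear maps *)

Section LinearFacts.
Variables (K : comNzRingType) (U V : lmodType K).

Lemma lin_fD (f : U -> V) : linear f -> {morph f : x y / x + y}.
Proof. by move=> f_lin x y; have := f_lin 1 x y; rewrite !scale1r. Qed.

Lemma lin_f0 (f : U -> V) : linear f -> f 0 = 0.
Proof. by move=> f_lin; apply: (addrI (f 0)); rewrite -lin_fD // !addr0. Qed.

Lemma lin_fZ (f : U -> V) : linear f -> forall c, {morph f : x / c *: x}.
Proof. by move=> f_lin c x; have := f_lin c x 0; rewrite lin_f0 // !addr0. Qed.

Lemma linear_comb (f : U -> V) x y u v :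
  linear f -> f (x *: u + y *: v) = x *: f u + y *: f v.
Proof. by move=> f_lin; rewrite f_lin lin_fZ. Qed.

(** The term in [y * y'] vanishes because the second components are taken in
    a square-zero part. *)
Lemma bilinear_comb (b : U -> U -> V) x y u v x' y' u' v' :
  (forall w, linear (b w)) -> (forall w, linear (b^~ w)) -> b v v' = 0 ->
  b (x *: u + y *: v) (x' *: u' + y' *: v')
  = ((x * x') *: b u u' + (x * y') *: b u v') + (y * x') *: b v u'.
Proof.
move=> b_linr b_linl bvv; rewrite (linear_comb x y u v (b_linl _)).
rewrite !(linear_comb x' y' u' v' (b_linr _)) bvv scaler0 addr0.
by rewrite scalerDr !scalerA.
Qed.

End LinearFacts.

(** * Linear maps on the algebra are determined by the basis *)

Section LinearExtension.
Variable R : realType.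
Implicit Types (h : basis_index -> W R) (x y : W R).

Definition lin_ext h x : W R := \sum_(i <- msupp x) x@_i *: h i.

(** Supports of sums are only bounded above, so linearity of [lin_ext] needs
    the freedom to sum over a larger common set. *)
Lemma lin_extEw h x (d : {fset basis_index}) :
  fsubset (msupp x) d -> lin_ext h x = \sum_(i <- d) x@_i *: h i.
Proof.
move=> sxd; rewrite /lin_ext (big_fset_incl _ sxd) // => i _.
by move/mcoeff_outdom=> ->; rewrite scale0r.
Qed.

Lemma lin_ext_linear h : linear (lin_ext h).
Proof.
move=> c x y; pose d := fsetU (msupp x) (fsetU (msupp y) (msupp (c *: x + y))).
have sx : fsubset (msupp x) d by rewrite fsubsetUl.
have sy : fsubset (msupp y) d by rewrite /d fsetUCA fsubsetUl.
have sz : fsubset (msupp (c *: x + y)) d by rewrite /d fsetUA fsubsetUr.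
rewrite (lin_extEw _ sx) (lin_extEw _ sy) (lin_extEw _ sz).
rewrite scaler_sumr -big_split /=; apply: eq_bigr => i _.
by rewrite mcoeffD mcoeffZ scalerDl scalerA.
Qed.

Lemma lin_ext_basis h i : lin_ext h << i >> = h i.
Proof. by rewrite /lin_ext msuppU oner_eq0 big_seq_fset1 mcoeffUU scale1r. Qed.

Lemma linear_expansion (f : W R -> W R) (x : W R) :
  linear f -> f x = lin_ext (fun i => f << i >>) x.
Proof.
move=> f_lin.
pose F : {linear W R -> W R} := HB.pack f (GRing.isLinear.Build _ _ _ _ f f_lin).
rewrite -[f]/(F : W R -> W R) {1}[x]monalgE linear_sum; apply: eq_bigr => i _.
rewrite -linearZ; congr (F _); apply/malgP => j.
by rewrite mcoeffZ !mcoeffU mulr_natr.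
Qed.

Lemma eq_linear_basis (f g : W R -> W R) :
  linear f -> linear g -> (forall i, f << i >> = g << i >>) -> f =1 g.
Proof.
move=> f_lin g_lin fg x; rewrite (linear_expansion _ f_lin) (linear_expansion _ g_lin).
by apply: eq_bigr => i _; rewrite fg.
Qed.

(** Either argument of the bilinear extension can be expanded first; the two
    groupings of the double sum give linearity on the left and on the right. *)
Lemma bilin_extEl b x y :
  bilin_ext b x y = lin_ext (fun i => lin_ext (b i) y) x.
Proof.
apply: eq_bigr => i _; rewrite scaler_sumr; apply: eq_bigr => j _.
by rewrite scalerA.
Qed.

Lemma bilin_extEr b x y :
  bilin_ext b x y = lin_ext (fun j => lin_ext (b^~ j) x) y.
Proof.
rewrite /bilin_ext exchange_big; apply: eq_bigr => j _.
by rewrite scaler_sumr; apply: eq_bigr => i _; rewrite scalerA mulrC.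
Qed.

Lemma bilin_ext_linearl b y : linear (bilin_ext b ^~ y).
Proof. by move=> c u v; rewrite !bilin_extEl lin_ext_linear. Qed.

Lemma bilin_ext_linearr b x : linear (bilin_ext b x).
Proof. by move=> c u v; rewrite !bilin_extEr lin_ext_linear. Qed.

End LinearExtension.

(** * The two products in the basis *)

Section Products.
Variable R : realType.
Implicit Types (n m : int).

Lemma WmulLL n m : Wmul (Lb R n) (Lb R m) = Lb R (n + m).
Proof. exact: bilin_ext_basis. Qed.
Lemma WmulLI n m : Wmul (Lb R n) (Ib R m) = Ib R (n + m).
Proof. exact: bilin_ext_basis. Qed.
Lemma WmulIL n m : Wmul (Ib R n) (Lb R m) = Ib R (n + m).
Proof. exact: bilin_ext_basis. Qed.
Lemma WmulII n m : Wmul (Ib R n) (Ib R m) = 0.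
Proof. exact: bilin_ext_basis. Qed.

Lemma Wmul1x (x : W R) : Wmul (Lb R 0) x = x.
Proof.
apply: (eq_linear_basis (bilin_ext_linearr (@mul_basis R) _) (g := id)) => //.
by case=> n; rewrite bilin_ext_basis /= add0r.
Qed.

Lemma Wmulx1 (x : W R) : Wmul x (Lb R 0) = x.
Proof.
apply: (eq_linear_basis (bilin_ext_linearl (@mul_basis R) _) (g := id)) => //.
by case=> n; rewrite bilin_ext_basis /= ?add0r addr0.
Qed.

(** Eigenvalues of [- [L_0, -]] on the basis vectors. *)
Definition weight (a : R[i]) (i : basis_index) : R[i] :=
  match i with inl n => n%:~R | inr m => m%:~R + a end.

Lemma adL0_basis a i : Wbracket a (Lb R 0) << i >> = - weight a i *: << i >>.
Proof.
rewrite /Wbracket bilin_ext_basis.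
case: i => n; rewrite /bracket_basis /weight.
  by rewrite sub0r rmorphN [(0 + n)%R]add0r.
by rewrite subr0 [(0 + n)%R]add0r.
Qed.

Lemma mcoeff_adL0 a (x : W R) i :
  (Wbracket a (Lb R 0) x)@_i = - weight a i * x@_i.
Proof.
rewrite (linear_expansion x (bilin_ext_linearr _ _) : Wbracket a (Lb R 0) x = _).
rewrite raddf_sum /=.
have -> : x@_i = \sum_(j <- msupp x) << x@_j *g j >>@_i.
  by rewrite -raddf_sum /= -monalgE.
rewrite mulr_sumr; apply: eq_bigr => j _.
rewrite -/(Wbracket a _ _) adL0_basis !mcoeffZ !mcoeffU; case: eqP => [->|_].
  by rewrite mulr1n mulr1 mulrC.
by rewrite !mulr0n !mulr0.
Qed.

(** All elements handled below have the shape x L_n + y I_m; the coordinates of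
    such elements and of their products are recorded once and for all. *)
Lemma mcoeff_combL x y n m p :
  (x *: Lb R n + y *: Ib R m)@_(inl p) = x * (n == p)%:R.
Proof.
rewrite mcoeffD [X in X + _]mcoeffZ [X in _ + X]mcoeffZ.
rewrite [X in _ + _ * X]mcoeffU [X in _ * X + _]mcoeffU.
by rewrite [_ *+ (inr _ == _)]mulr0n mulr0 addr0.
Qed.

Lemma mcoeff_combI x y n m p :
  (x *: Lb R n + y *: Ib R m)@_(inr p) = y * (m == p)%:R.
Proof.
rewrite mcoeffD [X in X + _]mcoeffZ [X in _ + X]mcoeffZ.
rewrite [X in _ + _ * X]mcoeffU [X in _ * X + _]mcoeffU.
by rewrite [_ *+ (inl _ == _)]mulr0n mulr0 add0r.
Qed.

Lemma Wmul_comb x y n m x' y' n' m' :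
  Wmul (x *: Lb R n + y *: Ib R m) (x' *: Lb R n' + y' *: Ib R m') =
  ((x * x') *: Lb R (n + n') + (x * y') *: Ib R (n + m'))
  + (y * x') *: Ib R (m + n').
Proof.
rewrite -WmulLL -WmulLI -WmulIL; apply: bilinear_comb.
- exact: bilin_ext_linearr.
- exact: bilin_ext_linearl.
- exact: WmulII.
Qed.

Lemma mcoeff_Wmul_combL x y n m x' y' n' m' p :
  (Wmul (x *: Lb R n + y *: Ib R m) (x' *: Lb R n' + y' *: Ib R m'))@_(inl p)
  = x * x' * (n + n' == p)%:R.
Proof.
rewrite Wmul_comb mcoeffD mcoeff_combL mcoeffZ mcoeffU.
by rewrite [_ *+ (inr _ == _)]mulr0n mulr0 addr0.
Qed.

Lemma mcoeff_Wmul_combI x y n m x' y' n' m' p :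
  (Wmul (x *: Lb R n + y *: Ib R m) (x' *: Lb R n' + y' *: Ib R m'))@_(inr p)
  = x * y' * (n + m' == p)%:R + y * x' * (m + n' == p)%:R.
Proof. by rewrite Wmul_comb mcoeffD mcoeff_combI mcoeffZ mcoeffU. Qed.

End Products.

(** * Functions on the integers with an addition formula *)

Lemma int_additive (V : zmodType) (g : int -> V) :
  (forall n m, g (n + m) = g n + g m) -> forall n, g n = g 1 *~ n.
Proof.
move=> gD n; have g0 : g 0 = 0.
  by apply: (addrI (g 0)); rewrite -gD !addr0.
have gS p : g (p + 1) = g p + g 1 by [].
elim/int_rect: n => [|n IHn|n IHn]; first by rewrite mulr0z.
  by rewrite -addn1 PoszD gS IHn mulrzDr mulr1z.
apply: (addIr (g 1)); rewrite -gS.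
by rewrite -addn1 PoszD opprD subrK IHn mulrzBr mulr1z subrK.
Qed.

Lemma int_exponential (F : fieldType) (g : int -> F) :
  g 0 = 1 -> (forall n m, g (n + m) = g n * g m) ->
  g 1 != 0 /\ forall n, g n = g 1 ^ n.
Proof.
move=> g0 gD; have g1 : g 1 != 0.
  apply: contra_eq_neq g0 => g1.
  by rewrite -(subrr (1 : int)) gD g1 mul0r eq_sym oner_neq0.
split=> // n; elim/int_rect: n => [|n IHn|n IHn]; first by rewrite g0 expr0z.
  by rewrite -addn1 PoszD gD IHn expfzDr // expr1z.
apply: (mulIf g1); rewrite -gD -{2}[g 1]expr1z -expfzDr //.
by rewrite -addn1 PoszD opprD subrK IHn.
Qed.

(** The quotient [y / x] is additive, hence proportional to the identity of the
    integers. *)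
Lemma int_exponential_derivation (F : fieldType) (x y : int -> F) :
  x 0 = 1 -> (forall n m, x (n + m) = x n * x m) ->
  (forall n m, y (n + m) = x n * y m + y n * x m) ->
  exists alpha c, [/\ alpha != 0, (y 1 = 0 -> c = 0),
    forall n, x n = alpha ^ n & forall n, y n = alpha ^ n * (c * n%:~R)].
Proof.
move=> x0 xD yD; have [x1 xE] := int_exponential x0 xD.
have xn n : x n != 0 by rewrite xE expfz_neq0.
exists (x 1), (y 1 / x 1); split=> // [->|n]; first by rewrite mul0r.
rewrite -xE mulrzr -(@int_additive _ (fun n => y n / x n)).
  by rewrite mulrC divfK.
by move=> p q; rewrite xD yD; field; rewrite !xn.
Qed.

(** * Classification of the automorphisms *)

(** The candidates for automorphisms: [alpha] and [mu] rescale, and [c] is the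
    size of the derivation sending L_n to n I_(n-k), which is compatible with
    the bracket only when a = k. *)
Definition standard_form (R : realType) (k : int) (alpha mu c : R[i])
    (f : W R -> W R) : Prop :=
  (forall n, f (Lb R n) =
     alpha ^ n *: (Lb R n + (c * n%:~R) *: Ib R (n - k))) /\
  (forall n, f (Ib R n) = (mu * alpha ^ n) *: Ib R n).

(** One integer [k] serves both cases: it is a when a is an integer, and
    arbitrary otherwise, the hypothesis [a_int] being then vacuous. *)
Section Classification.
Variables (R : realType) (a : R[i]) (f : W R -> W R) (k : int).
Hypothesis f_aut : is_automorphism a f.
Hypothesis a_int : forall m : int, a = m%:~R -> m = k.

Let f_lin : linear f. Proof. by case: f_aut. Qed.
Let f_mul x y : f (Wmul x y) = Wmul (f x) (f y). Proof. by case: f_aut. Qed.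

Let x n : R[i] := (f (Lb R n))@_(inl n).
Let y n : R[i] := (f (Lb R n))@_(inr (n - k)).
Let u n : R[i] := (f (Ib R n))@_(inr n).
Let v n : R[i] := (f (Ib R n))@_(inl (n + k)).

Lemma automorphism_L0 : f (Lb R 0) = Lb R 0.
Proof.
case: f_aut => _ [g _ gK] _ _.
by rewrite -[LHS]Wmulx1 -{2}[Lb R 0]gK -f_mul Wmul1x gK.
Qed.

(** Since f fixes L_0, it commutes with [L_0, -] and preserves its eigenspaces. *)
Lemma automorphism_weight i j : weight a i != weight a j -> (f << j >>)@_i = 0.
Proof.
move=> wij; case: f_aut => _ _ _ f_br.
have /(congr1 (mcoeff i)) := f_br (Lb R 0) << j >>.
rewrite automorphism_L0 mcoeff_adL0 adL0_basis (lin_fZ f_lin) mcoeffZ.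
move/eqP; rewrite -subr_eq0 -mulrBl mulf_eq0 => /orP[|/eqP //].
by rewrite opprK addrC subr_eq0 (negPf wij).
Qed.

Lemma automorphism_Lb n : f (Lb R n) = x n *: Lb R n + y n *: Ib R (n - k).
Proof.
apply/malgP; case=> m.
  rewrite [RHS]mcoeff_combL; case: eqVneq => [->|nm]; first by rewrite mulr1.
  by rewrite mulr0; apply: automorphism_weight; rewrite /= eqr_int eq_sym.
rewrite [RHS]mcoeff_combI; case: eqVneq => [<-|nm]; first by rewrite mulr1.
rewrite mulr0; apply: automorphism_weight => /=; apply: contra_neq nm => nm.
have /a_int <- : a = (n - m)%:~R by rewrite rmorphB /= -nm addrC addKr.
by rewrite opprB addrC subrK.
Qed.

Lemma automorphism_Ib n : f (Ib R n) = v n *: Lb R (n + k) + u n *: Ib R n.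
Proof.
apply/malgP; case=> m.
  rewrite [RHS]mcoeff_combL; case: eqVneq => [<-|nm]; first by rewrite mulr1.
  rewrite mulr0; apply: automorphism_weight => /=; apply: contra_neq nm => nm.
  have /a_int <- : a = (m - n)%:~R by rewrite rmorphB /= nm addrC addKr.
  by rewrite addrC subrK.
rewrite [RHS]mcoeff_combI; case: eqVneq => [->|nm]; first by rewrite mulr1.
rewrite mulr0; apply: automorphism_weight.
by rewrite /= (can_eq (addrK _)) eqr_int eq_sym.
Qed.

Let y_eq0 : a <> k%:~R -> forall n, y n = 0.
Proof.
move=> ak n; apply: automorphism_weight => /=; apply/eqP => nk; apply: ak.
by apply: (addrI (n - k)%:~R); rewrite nk -rmorphD /= subrK.
Qed.

Let xD n m : x (n + m) = x n * x m.
Proof.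
rewrite {1}/x -WmulLL f_mul !automorphism_Lb mcoeff_Wmul_combL.
by rewrite eqxx mulr1.
Qed.

Let yD n m : y (n + m) = x n * y m + y n * x m.
Proof.
rewrite {1}/y -WmulLL f_mul !automorphism_Lb mcoeff_Wmul_combI.
by rewrite addrA eqxx addrAC eqxx !mulr1.
Qed.

Let x0 : x 0 = 1.
Proof. by rewrite /x automorphism_L0 [LHS]mcoeffU. Qed.

(** The square of f (I_0) is f (0) = 0, and its coordinate on L_(2k) is the
    square of [v 0]. *)
Let v0 : v 0 = 0.
Proof.
have : (f (Wmul (Ib R 0) (Ib R 0)))@_(inl (0 + k + (0 + k))) = 0.
  by rewrite WmulII (lin_f0 f_lin) mcoeff0.
rewrite f_mul !automorphism_Ib mcoeff_Wmul_combL eqxx mulr1 => /eqP.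
by rewrite mulf_eq0 orbb => /eqP.
Qed.

Let u0_neq0 : u 0 != 0.
Proof.
apply/eqP => u0; case: f_aut => _ /bij_inj f_inj _ _.
have /f_inj : f (Ib R 0) = f 0.
  by rewrite (lin_f0 f_lin) automorphism_Ib v0 u0 !scale0r addr0.
move/(congr1 (mcoeff (inr 0))); rewrite mcoeff0 mcoeffU => /eqP.
by rewrite oner_eq0.
Qed.

(** Here and in [vE], f (I_n) is computed as f (L_n) f (I_0). *)
Let uE n : u n = x n * u 0.
Proof.
rewrite {1}/u -[n in Ib R n]addr0 -WmulLI f_mul automorphism_Lb automorphism_Ib.
by rewrite mcoeff_Wmul_combI addr0 eqxx mulr1 v0 mulr0 mul0r addr0.
Qed.

Let vE n : v n = 0.
Proof.
rewrite {1}/v -[n in Ib R n]addr0 -WmulLI f_mul automorphism_Lb automorphism_Ib.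
by rewrite mcoeff_Wmul_combL v0 mulr0 mul0r.
Qed.

Lemma automorphism_form : exists alpha mu c,
  [/\ alpha != 0, mu != 0, a <> k%:~R -> c = 0 & standard_form k alpha mu c f].
Proof.
have [alpha [c [alpha0 c0 xE yE]]] := int_exponential_derivation x0 xD yD.
exists alpha, (u 0), c; split; [exact: alpha0|exact: u0_neq0| |split=> n].
- by move=> ak; apply/c0/y_eq0.
- by rewrite automorphism_Lb xE yE scalerDr scalerA.
- by rewrite automorphism_Ib vE uE xE scale0r add0r [u 0 * _]mulrC.
Qed.

End Classification.

(** * An element with trivial stabiliser *)

(** The index 2 - k is chosen different from 1 - k, the place where the parameter
    [c] of f (L_1) shows, so that [c] and [mu] can be read off separately. *)
Lemma standard_form_determined R k alpha mu c alpha' mu' c' (f g : W R -> W R) :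
  linear f -> linear g ->
  standard_form k alpha mu c f -> standard_form k alpha' mu' c' g ->
  alpha != 0 -> f (Lb R 1 + Ib R (2 - k)) = g (Lb R 1 + Ib R (2 - k)) ->
  f =1 g.
Proof.
move=> f_lin g_lin [fL fI] [gL gI] alpha0.
rewrite (lin_fD f_lin) (lin_fD g_lin) fL fI gL gI => fg.
have k12 : (2 - k == 1 - k) = false by rewrite (can_eq (addrK _)).
have k21 : (1 - k == 2 - k) = false by rewrite eq_sym.
pose image b nu d := b ^ 1 *: (Lb R 1 + (d * 1%:~R) *: Ib R (1 - k))
                     + (nu * b ^ (2 - k)) *: Ib R (2 - k).
have imageL b nu d p : (image b nu d)@_(inl p) = b * (1 == p)%:R.
  rewrite /image expr1z scalerDr scalerA mcoeffD mcoeff_combL.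
  by rewrite [X in _ + X]mcoeffZ mcoeffU [_ *+ (inr _ == _)]mulr0n mulr0 addr0.
have imageI b nu d p : (image b nu d)@_(inr p)
    = b * d * (1 - k == p)%:R + nu * b ^ (2 - k) * (2 - k == p)%:R.
  rewrite /image expr1z scalerDr scalerA mcoeffD mcoeff_combI mulr1.
  by rewrite [X in _ + X]mcoeffZ mcoeffU.
(* Both sides are the images of L_1 + I_(2-k), written with the parameters. *)
have {}fg : image alpha mu c = image alpha' mu' c' by [].
have eqL p := etrans (esym (imageL alpha mu c p))
  (etrans (congr1 (mcoeff (inl p)) fg) (imageL alpha' mu' c' p)).
have eqI p := etrans (esym (imageI alpha mu c p))
  (etrans (congr1 (mcoeff (inr p)) fg) (imageI alpha' mu' c' p)).
have E : alpha = alpha' by move: (eqL 1); rewrite eqxx 2!mulr1.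
rewrite -{}E in eqI gL gI.
have E : c = c'.
  by move: (eqI (1 - k)); rewrite k12 eqxx 2!mulr0 2!addr0 2!mulr1 => /(mulfI alpha0).
rewrite -{}E in gL.
have E : mu = mu'.
  move: (eqI (2 - k)); rewrite k21 eqxx 2!mulr0 2!add0r 2!mulr1.
  by apply: mulIf; rewrite expfz_neq0.
rewrite -{}E in gI.
apply: (eq_linear_basis f_lin g_lin); case=> n.
  exact: etrans (fL n) (esym (gL n)).
exact: etrans (fI n) (esym (gI n)).
Qed.

(* For a in Z the map fixing every I_n and sending L_n to L_n + n I_{n-a} is an
   automorphism, so the diagonal form of the second clause needs a outside Z;
   the third clause gives the corresponding form for integral a. *)
Theorem theorem3p6 (R : realType) (a : R[i]) (A : W R -> W R)
    (hA : is_2local_automorphism a A) :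
  [/\ is_automorphism a A,
      (forall k : int, a <> k%:~R) ->
        exists alpha mu : R[i],
          [/\ alpha != 0, mu != 0, linear A,
              (forall n : int, A (Lb R n) = alpha ^ n *: Lb R n)
            & (forall n : int, A (Ib R n) = (mu * alpha ^ n) *: Ib R n)]
    & forall k : int, a = k%:~R ->
        exists alpha mu c : R[i],
          [/\ alpha != 0, mu != 0, linear A,
              (forall n : int, A (Lb R n) =
                 alpha ^ n *: (Lb R n + (c * n%:~R) *: Ib R (n - k)))
            & (forall n : int, A (Ib R n) = (mu * alpha ^ n) *: Ib R n)]].
Proof.
have int_inj (p q : int) : a = p%:~R -> a = q%:~R -> p = q.
  by move=> -> /intr_inj.
have [k a_int] : exists k : int, forall m : int, a = m%:~R -> m = k.
  have [[k ak]|nint] := EM (exists k : int, a = k%:~R).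
    by exists k => m am; apply: int_inj am ak.
  by exists 0 => m am; case: nint; exists m.
pose z := Lb R 1 + Ib R (2 - k).
have [phi [phi_aut Az _]] := hA z z.
have A_phi : A = phi.
  apply/funext => x; have [f [f_aut Azf ->]] := hA z x.
  have [al [mu [c [al0 _ _ f_form]]]] := automorphism_form f_aut a_int.
  have [al' [mu' [c' [_ _ _ phi_form]]]] := automorphism_form phi_aut a_int.
  apply: (standard_form_determined _ _ f_form phi_form) => //.
  - by case: f_aut.
  - by case: phi_aut.
  - by rewrite -/z -Azf.
have A_aut : is_automorphism a A by rewrite A_phi.
have A_lin : linear A by case: A_aut.
have [al [mu [c [al0 mu0 c0 [AL AI]]]]] := automorphism_form A_aut a_int.
split=> // [nint|l al_int].
  exists al, mu; split; [exact: al0|exact: mu0|exact: A_lin| |exact: AI] => n.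
  by rewrite AL (c0 (nint k)) mul0r scale0r addr0.
exists al, mu, c; split; [exact: al0|exact: mu0|exact: A_lin| |exact: AI].
by rewrite (a_int l al_int).
Qed.
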